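(* Let $(X,\{\alpha_i\},Y,\{h_i\})$ be a root datum of finite type and let $\pi\subset X^+$ be a finite saturated set. Then the defining ideal $\Lambda$ of the generalized $q$-Schur algebra $\mathbf{S}(\pi)=\mathbf{U}/\Lambda$ is the two-sided ideal of $\mathbf{U}$ generated by all elements $\prod_{\lambda\in W\pi}(K_h-v^{\langle h,\lambda\rangle})$ for $h\in Y$.
   Context: **Root datum.** A Cartan datum is a finite set $I$ with a symmetric $\mathbb{Z}$-valued bilinear form $(\ ,\ )$ on $\mathbb{Z}[I]$ such that $(i,i)\in\{2,4,6,\dots\}$ for $i\in I$ and $2(i,j)/(i,i)\in\{0,-1,-2,\dots\}$ for $i\ne j$. It is of finite type if the matrix $((i,j))_{i,j\in I}$ is positive definite. A root datum associated to it consists of finitely generated free abelian groups $X,Y$, a perfect pairing $\langle\ ,\ \rangle:Y\times X\to\mathbb{Z}$, and embeddings $I\to Y$, $i\mapsto h_i$, and $I\to X$, $i\mapsto\alpha_i$, with $\langle h_i,\alpha_j\rangle=2(i,j)/(i,i)$. The root datum is of finite type if its Cartan datum is. Put $d_i=(i,i)/2$. The Weyl group $W$ is generated by $s_i$ ($i\in I$) and acts on $X$ by $s_i(\lambda)=\lambda-\langle h_i,\lambda\rangle\alpha_i$. Write $\lambda\le\lambda'$ if $\lambda'-\lambda\in\sum_i\mathbb{N}\alpha_i$, and $X^+=\{\lambda\in X\mid\langle h_i,\lambda\rangle\in\mathbb{N}\text{ for all }i\}$. A subset $\pi\subset X^+$ is saturated if $\lambda\in\pi$, $\lambda'\in X^+$,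 $\lambda'\le\lambda$ imply $\lambda'\in\pi$. $W\pi\subset X$ is the union of the $W$-orbits of elements of $\pi$. **Quantized enveloping algebra.** Let $v$ be an indeterminate, $v_i=v^{d_i}$, $[n]_i=(v_i^n-v_i^{-n})/(v_i-v_i^{-1})$, $[n]_i^!=[1]_i\cdots[n]_i$. $\mathbf{U}$ is the associative unital $\mathbb{Q}(v)$-algebra with generators $E_i,F_i$ ($i\in I$), $K_h$ ($h\in Y$) and relations: $K_0=1$, $K_hK_{h'}=K_{h+h'}$; $K_hE_i=v^{\langle h,\alpha_i\rangle}E_iK_h$; $K_hF_i=v^{-\langle h,\alpha_i\rangle}F_iK_h$; $E_iF_j-F_jE_i=\delta_{ij}\dfrac{K_{d_ih_i}-K_{-d_ih_i}}{v_i-v_i^{-1}}$; and for $i\ne j$, $\sum_{s+s'=1-\langle h_i,\alpha_j\rangle}(-1)^{s'}E_i^{(s)}E_jE_i^{(s')}=0$ and the same with $F$ in place of $E$, where $E_i^{(s)}=E_i^s/[s]_i^!$, $F_i^{(s)}=F_i^s/[s]_i^!$. **Generalized $q$-Schur algebra.** For a $\mathbf{U}$-module $V$ and $\lambda\in X$, $V_\lambda=\{m\in V\mid K_hm=v^{\langle h,\lambda\rangle}m\ \forall h\in Y\}$. $\mathcal{C}$ is the category of $\mathbf{U}$-modules $V$ with $V=\bigoplus_{\lambda\in X}V_\lambda$, and $\mathcal{C}[\pi]$ is its full subcategory of those $M$ with $M=\bigoplus_{\lambda\in W\pi}M_\lambda$. The defining ideal $\Lambda$ is the ideal of all elements of $\mathbf{U}$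 annihilating every object of $\mathcal{C}[\pi]$, and $\mathbf{S}(\pi)=\mathbf{U}/\Lambda$. *)

(* Defs.v *)
From HB Require Import structures.
From mathcomp Require Import all_boot all_order all_algebra.
From mathcomp Require Import finmap boolp classical_sets cardinality.
From mathcomp.multinomials Require Import monalg.

Set Implicit Arguments.
Unset Strict Implicit.
Unset Printing Implicit Defensive.

Import Order.TTheory GRing.Theory Num.Theory.

Local Open Scope classical_set_scope.
Local Open Scope ring_scope.

Section TwoSidedIdeal.
Variable A : pzRingType.

(* Closure under opposite follows from multiplication by -1. *)
Definition two_sided_ideal (J : set A) : Prop :=
  [/\ J 0, forall x y, J x -> J y -> J (x + y),
      forall a x, J x -> J (a * x) & forall a x, J x -> J (x * a)].

Definition ideal_gen (G : set A) : set A :=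
  [set x | forall J, two_sided_ideal J -> G `<=` J -> J x].

Lemma ideal_genP G : two_sided_ideal (ideal_gen G).
Proof.
split=> [J [] //|x y Gx Gy|a x Gx|a x Gx] J iJ GJ; case: (iJ) => _ JD Jl Jr.
- by apply: JD; [apply: Gx|apply: Gy].
- by apply: Jl; apply: Gx.
- by apply: Jr; apply: Gx.
Qed.

Record ideal := Ideal {
  ideal_set :> A -> Prop;
  idealP : two_sided_ideal ideal_set }.

Definition gen_ideal (G : set A) : ideal := Ideal (ideal_genP G).

End TwoSidedIdeal.

(* The library only builds quotients of commutative rings. *)
Section Quotient.
Variables (A : pzRingType) (J : ideal A).

Local Open Scope quotient_scope.

Definition ideal_equiv (x y : A) : bool := `[< J (x - y) >].

Let J0 : J 0. Proof. by case: (idealP J). Qed.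
Let JD x y : J x -> J y -> J (x + y).
Proof. by case: (idealP J) => _ + _ _; apply. Qed.
Let JMl a x : J x -> J (a * x).
Proof. by case: (idealP J) => _ _ + _; apply. Qed.
Let JMr a x : J x -> J (x * a).
Proof. by case: (idealP J) => _ _ _ +; apply. Qed.
Let JN x : J x -> J (- x).
Proof. by rewrite -mulN1r; apply: JMl. Qed.

Lemma ideal_equiv_class : equiv_class_of ideal_equiv.
Proof.
split=> [x|x y|y x z].
- by apply/asboolP; rewrite subrr.
- by apply/asboolP/asboolP => /JN; rewrite opprB.
- move=> /asboolP xy /asboolP yz; apply/asboolP.
  by rewrite -(subrKA y); apply: JD.
Qed.

Canonical ideal_equivRel := EquivRelPack ideal_equiv_class.

Definition quot := {eq_quot ideal_equivRel}.

HB.instance Definition _ := Choice.on quot.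
HB.instance Definition _ : EqQuotient A ideal_equivRel quot :=
  EqQuotient.on quot.

Definition quot_pi (x : A) : quot := \pi_quot x.

Lemma quot_eqP x y : reflect (J (x - y)) (quot_pi x == quot_pi y).
Proof. by rewrite /quot_pi eqmodE; apply: asboolP. Qed.

Lemma quot_reprP x : J (repr (quot_pi x) - x).
Proof. by apply/quot_eqP; rewrite /quot_pi reprK. Qed.

Lemma quotW (P : quot -> Prop) : (forall x, P (quot_pi x)) -> forall q, P q.
Proof. by move=> Ppi q; rewrite -[q]reprK; apply: Ppi. Qed.

Definition quot_opp (q : quot) : quot := quot_pi (- repr q).
Definition quot_add (p q : quot) : quot := quot_pi (repr p + repr q).
Definition quot_mul (p q : quot) : quot := quot_pi (repr p * repr q).

Lemma quot_oppE x : quot_opp (quot_pi x) = quot_pi (- x).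
Proof. by apply/eqP/quot_eqP; rewrite -opprD; apply/JN/quot_reprP. Qed.

Lemma quot_addE x y :
  quot_add (quot_pi x) (quot_pi y) = quot_pi (x + y).
Proof.
apply/eqP/quot_eqP; rewrite opprD addrACA.
by apply: JD; apply: quot_reprP.
Qed.

Lemma quot_mulE x y :
  quot_mul (quot_pi x) (quot_pi y) = quot_pi (x * y).
Proof.
apply/eqP/quot_eqP; rewrite -(subrKA (x * repr (quot_pi y))).
rewrite -mulrBl -mulrBr.
by apply: JD; [apply: JMr|apply: JMl]; apply: quot_reprP.
Qed.

Fact quot_addA : associative quot_add.
Proof.
elim/quotW=> x; elim/quotW=> y; elim/quotW=> z.
by rewrite !quot_addE addrA.
Qed.

Fact quot_addC : commutative quot_add.
Proof. by elim/quotW=> x; elim/quotW=> y; rewrite !quot_addE addrC. Qed.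

Fact quot_add0 : left_id (quot_pi 0) quot_add.
Proof. by elim/quotW=> x; rewrite quot_addE add0r. Qed.

Fact quot_addN : left_inverse (quot_pi 0) quot_opp quot_add.
Proof. by elim/quotW=> x; rewrite quot_oppE quot_addE addNr. Qed.

HB.instance Definition _ := GRing.isZmodule.Build quot
  quot_addA quot_addC quot_add0 quot_addN.

Fact quot_mulA : associative quot_mul.
Proof.
elim/quotW=> x; elim/quotW=> y; elim/quotW=> z.
by rewrite !quot_mulE mulrA.
Qed.

Fact quot_mul1l : left_id (quot_pi 1) quot_mul.
Proof. by elim/quotW=> x; rewrite quot_mulE mul1r. Qed.

Fact quot_mul1r : right_id (quot_pi 1) quot_mul.
Proof. by elim/quotW=> x; rewrite quot_mulE mulr1. Qed.

Fact quot_mulDl : left_distributive quot_mul +%R.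
Proof.
elim/quotW=> x; elim/quotW=> y; elim/quotW=> z.
by rewrite /= -![_ + _]/(quot_add _ _) !(quot_addE, quot_mulE) mulrDl.
Qed.

Fact quot_mulDr : right_distributive quot_mul +%R.
Proof.
elim/quotW=> x; elim/quotW=> y; elim/quotW=> z.
by rewrite /= -![_ + _]/(quot_add _ _) !(quot_addE, quot_mulE) mulrDr.
Qed.

HB.instance Definition _ := GRing.Zmodule_isPzRing.Build quot
  quot_mulA quot_mul1l quot_mul1r quot_mulDl quot_mulDr.

Fact quot_pi_zmod_morphism : zmod_morphism quot_pi.
Proof.
by move=> x y; rewrite -[RHS]/(quot_add _ (quot_opp _)) quot_oppE quot_addE.
Qed.

Fact quot_pi_monoid_morphism : monoid_morphism quot_pi.
Proof. by split=> // x y; rewrite -[RHS]/(quot_mul _ _) quot_mulE. Qed.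

HB.instance Definition _ :=
  GRing.isZmodMorphism.Build A quot quot_pi quot_pi_zmod_morphism.
HB.instance Definition _ :=
  GRing.isMonoidMorphism.Build A quot quot_pi quot_pi_monoid_morphism.

Lemma quot_oner_neq0 : ~ J 1 -> 1 != 0 :> quot.
Proof. by move=> J1; apply/negP => /quot_eqP; rewrite subr0. Qed.

End Quotient.

Section QuotientAlgebra.
Variables (k : nzRingType) (A : algType k) (J : ideal A).

Definition quot_scale (c : k) (x : quot J) : quot J := quot_pi J c%:A * x.

Lemma quot_scaleE c x : quot_scale c (quot_pi J x) = quot_pi J (c *: x).
Proof. by rewrite /quot_scale -rmorphM mulr_algl. Qed.

Fact quot_scaleA a b x : quot_scale a (quot_scale b x) = quot_scale (a * b) x.
Proof. by elim/quotW: x => x; rewrite !quot_scaleE scalerA. Qed.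

Fact quot_scale1 : left_id 1 quot_scale.
Proof. by elim/quotW=> x; rewrite quot_scaleE scale1r. Qed.

Fact quot_scaleDr : right_distributive quot_scale +%R.
Proof. by move=> a x y; rewrite /quot_scale mulrDr. Qed.

Fact quot_scaleDl x : {morph quot_scale^~ x : a b / a + b}.
Proof. by move=> a b; rewrite /quot_scale scalerDl rmorphD mulrDl. Qed.

HB.instance Definition _ := GRing.Zmodule_isLmodule.Build k (quot J)
  quot_scaleA quot_scale1 quot_scaleDr quot_scaleDl.

Fact quot_scalerAl (a : k) (x y : quot J) : a *: (x * y) = (a *: x) * y.
Proof. exact: mulrA. Qed.

Fact quot_scalerAr (a : k) (x y : quot J) : a *: (x * y) = x * (a *: y).
Proof.
elim/quotW: x => x; elim/quotW: y => y.
rewrite -rmorphM -![a *: _]/(quot_scale a _) !quot_scaleE -rmorphM.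
by rewrite scalerAr.
Qed.

End QuotientAlgebra.

Section FreeAlgebra.
Variables (F : comNzRingType) (T : choiceType).

Fact free_alg_scalerAr (a : F) (x y : {malg F[{fmonom T}]}) :
  a *: (x * y) = x * (a *: y).
Proof.
suff scalerAr_central (A : lalgType F) (c u w : A) :
    (forall z : A, c * z = a *: z) -> u * c = c * u ->
    a *: (u * w) = u * (a *: w).
  apply: (scalerAr_central _ a%:MP) => [z|]; first exact: mul_malgC.
  rewrite !malgM_def fgmulUg fgmulgU; apply: eq_bigr => k _.
  by rewrite mulm1 mul1m mulrC.
by move=> cE uc; rewrite -!cE !mulrA uc.
Qed.

Definition free_alg := {malg F[{fmonom T}]}.

HB.instance Definition _ := GRing.Lalgebra.on free_alg.

HB.instance Definition _ :=
  GRing.Lalgebra_isAlgebra.Build F free_alg free_alg_scalerAr.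

Definition free_gen (t : T) : free_alg := << fmu t >>.

End FreeAlgebra.

Section CartanDatum.
Variable I : finType.

(* The bilinear form on Z[I] is given by its values (i, j) on the basis I. *)
Record cartan_datum := CartanDatum {
  cartan_form :> I -> I -> int;
  cartan_form_sym : forall i j, cartan_form i j = cartan_form j i;
  cartan_form_diag : forall i,
    exists2 n : nat, (0 < n)%N & cartan_form i i = (2 * n)%N;
  cartan_form_offdiag : forall i j, i != j -> exists n : nat,
    2 * (cartan_form i j)%:Q / (cartan_form i i)%:Q = - n%:Q }.

Definition cartan_d (C : cartan_datum) (i : I) : nat := (`|C i i| %/ 2)%N.

(* For an integral matrix, positive definiteness over the rationals and over
   the reals agree: rational vectors are dense, and the isotropic vectors of a
   positive semidefinite matrix are its kernel, which is defined over Q. *)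
Definition cartan_finite (C : cartan_datum) : Prop :=
  forall x : I -> rat, (exists i, x i != 0) ->
    0 < \sum_i \sum_j x i * (C i j)%:Q * x j.

End CartanDatum.

Definition fg_free (M : zmodType) : Prop :=
  exists (n : nat) (b : 'I_n -> M),
    bijective (fun c : {ffun 'I_n -> int} => \sum_i b i *~ c i).

Section RootDatum.
Variables (I : finType) (C : cartan_datum I) (X Y : zmodType).

Record root_datum := RootDatum {
  X_free : fg_free X;
  Y_free : fg_free Y;
  pairing : Y -> X -> int;
  pairingDl : forall h h' l, pairing (h + h') l = pairing h l + pairing h' l;
  pairingDr : forall h l l', pairing h (l + l') = pairing h l + pairing h l';
  pairing_perfectl : forall f : {additive X -> int},
    exists! h, forall l, pairing h l = f l;
  pairing_perfectr : forall f : {additive Y -> int},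
    exists! l, forall h, pairing h l = f h;
  simple_coroot : I -> Y;
  simple_root : I -> X;
  simple_coroot_inj : injective simple_coroot;
  simple_root_inj : injective simple_root;
  pairing_root : forall i j,
    (pairing (simple_coroot i) (simple_root j))%:Q =
    2 * (C i j)%:Q / (C i i)%:Q }.

Variable R : root_datum.

Local Notation "<[ h , l ]>" := (pairing R h l) (format "<[ h ,  l ]>").
Local Notation h_ := (simple_coroot R).
Local Notation alpha := (simple_root R).

Definition simple_refl (i : I) (l : X) : X := l - alpha i *~ <[h_ i, l]>.

(* The Weyl group, as the group of transformations of X generated by the
   simple reflections. *)
Inductive weyl : (X -> X) -> Prop :=
| weyl_id : weyl id
| weyl_refl i : weyl (simple_refl i)
| weyl_comp w w' : weyl w -> weyl w' -> weyl (w \o w')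
| weyl_inv w w' : weyl w -> cancel w w' -> cancel w' w -> weyl w'.

Definition weyl_orbits (pi : set X) : set X :=
  [set l | exists w l0, [/\ weyl w, pi l0 & l = w l0]].

Definition weight_le (l l' : X) : Prop :=
  exists n : I -> nat, l' - l = \sum_i alpha i *+ n i.

Definition dominant : set X := [set l | forall i, 0 <= <[h_ i, l]>].

Definition saturated (pi : set X) : Prop :=
  forall l l', pi l -> dominant l' -> weight_le l' l -> pi l'.

(* U and its modules are set up over a field k with a parameter q; the theorem
   takes k = Q(v) and q = v. *)
Variables (k : fieldType) (q : k).

Definition q_ (i : I) : k := q ^+ cartan_d C i.
Definition qint (i : I) (n : nat) : k :=
  (q_ i ^+ n - q_ i ^- n) / (q_ i - (q_ i)^-1).
Definition qfact (i : I) (n : nat) : k := \prod_(1 <= m < n.+1) qint i m.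

Section Relations.
Variables (A : algType k) (E F : I -> A) (K : Y -> A).

Definition div_pow (x : I -> A) (i : I) (s : nat) : A :=
  (qfact i s)^-1 *: x i ^+ s.

(* For i != j, 1 - <[h_ i, alpha j]> is a positive integer. *)
Definition serre (x : I -> A) (i j : I) : A :=
  let m := `|1 - <[h_ i, alpha j]>|%N in
  \sum_(s < m.+1) \sum_(s' < m.+1 | (s + s' == m)%N)
    (-1) ^+ s' * div_pow x i s * x j * div_pow x i s'.

(* The elements that the defining relations of U set to zero. *)
Inductive relator : A -> Prop :=
| rel_K0 : relator (K 0 - 1)
| rel_KK h h' : relator (K h * K h' - K (h + h'))
| rel_KE h i : relator (K h * E i - q ^ <[h, alpha i]> *: (E i * K h))
| rel_KF h i : relator (K h * F i - q ^ (- <[h, alpha i]>) *: (F i * K h))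
| rel_EF i j : relator (E i * F j - F j * E i -
    (i == j)%:R *: ((q_ i - (q_ i)^-1)^-1 *:
      (K (h_ i *+ cartan_d C i) - K (- (h_ i *+ cartan_d C i)))))
| rel_serreE i j : i != j -> relator (serre E i j)
| rel_serreF i j : i != j -> relator (serre F i j).

Lemma relator_augmentation (f : {rmorphism A -> k}) :
    (forall c x, f (c *: x) = c * f x) ->
    (forall i, f (E i) = 0) -> (forall i, f (F i) = 0) ->
    (forall h, f (K h) = 1) ->
  forall x, relator x -> f x = 0.
Proof.
move=> fZ fE fF fK _ [|h h'|h i|h i|i j|i j _|i j _].
- by rewrite rmorphB rmorph1 fK subrr.
- by rewrite rmorphB rmorphM !fK mulr1 subrr.
- by rewrite rmorphB fZ !rmorphM fE mulr0 mul0r mulr0 subrr.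
- by rewrite rmorphB fZ !rmorphM fF mulr0 mul0r mulr0 subrr.
- by rewrite !rmorphB !rmorphM fE fF !fZ rmorphB !fK !subrr !mulr0 subrr.
- rewrite rmorph_sum big1 // => s _; rewrite rmorph_sum big1 // => s' _.
  by rewrite !rmorphM fE mulr0 mul0r.
- rewrite rmorph_sum big1 // => s _; rewrite rmorph_sum big1 // => s' _.
  by rewrite !rmorphM fF mulr0 mul0r.
Qed.

End Relations.

Definition gens : choiceType := (I + I + Y)%type.

Local Notation free := (free_alg k gens).

Definition freeE (i : I) : free := free_gen k (inl (inl i) : gens).
Definition freeF (i : I) : free := free_gen k (inl (inr i) : gens).
Definition freeK (h : Y) : free := free_gen k (inr h : gens).

Definition Uq := quot (gen_ideal (relator freeE freeF freeK : set free)).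

HB.instance Definition _ := GRing.PzRing.on Uq.
HB.instance Definition _ := GRing.Lmodule.on Uq.

Definition Uq_pi (x : free) : Uq := quot_pi _ x.

HB.instance Definition _ := GRing.RMorphism.copy Uq_pi (@quot_pi free _).

Definition counit_gen (g : gens) : k := if g is inr _ then 1 else 0.
Definition counit_monom (m : {fmonom gens}) : k :=
  \prod_(g <- (m : seq gens)) counit_gen g.

Fact counit_monom_mmorphism : mmorphism counit_monom.
Proof.
split=> [m m'|]; first by rewrite /counit_monom fmM big_cat.
by rewrite /counit_monom fm1 big_nil.
Qed.

HB.instance Definition _ :=
  isMultiplicative.Build _ _ counit_monom counit_monom_mmorphism.

Definition counit : free -> k := mmap idfun counit_monom.

HB.instance Definition _ := GRing.RMorphism.on counit.

Lemma counitZ c x : counit (c *: x) = c * counit x.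
Proof. exact: mmapZ. Qed.

Lemma counit_free_gen g : counit (free_gen k g) = counit_gen g.
Proof. by rewrite /counit mmapU /= mul1r /counit_monom fmuE big_seq1. Qed.

Lemma counit_relator x : relator freeE freeF freeK x -> counit x = 0.
Proof.
apply: relator_augmentation => [c y|i|i|h]; first exact: counitZ.
- exact: counit_free_gen.
- exact: counit_free_gen.
- exact: counit_free_gen.
Qed.

Fact Uq_oner_neq0 : 1 != 0 :> Uq.
Proof.
apply: quot_oner_neq0 => /(_ [set x | counit x = 0]) /= J1.
suff /eqP : counit 1 = 0 by rewrite rmorph1 oner_eq0.
apply: J1; last exact: counit_relator.
split=> [|x y /= cx cy|a x /= cx|a x /= cx]; first exact: rmorph0.
- by rewrite rmorphD /= cx cy addr0.
- by rewrite rmorphM /= cx mulr0.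
- by rewrite rmorphM /= cx mul0r.
Qed.

HB.instance Definition _ := GRing.PzSemiRing_isNonZero.Build Uq Uq_oner_neq0.
HB.instance Definition _ :=
  GRing.Lmodule_isLalgebra.Build k Uq (@quot_scalerAl _ _ _).
HB.instance Definition _ :=
  GRing.Lalgebra_isAlgebra.Build k Uq (@quot_scalerAr _ _ _).

Definition UqE (i : I) : Uq := Uq_pi (freeE i).
Definition UqF (i : I) : Uq := Uq_pi (freeF i).
Definition UqK (h : Y) : Uq := Uq_pi (freeK h).

(* A U-module is a Q(v)-vector space through the scalars c%:A of Uq. *)
Definition weight_space (V : lmodType Uq) (l : X) : set V :=
  [set m | forall h, UqK h *: m = (q ^ <[h, l]>)%:A *: m].

(* V is the internal direct sum of the W l for l in D. *)
Definition direct_sum (V : zmodType) (D : set X) (W : X -> set V) : Prop :=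
  (forall m : V, exists (s : seq X) (f : X -> V),
     [/\ uniq s, forall l, l \in s -> D l /\ W l (f l)
        & m = \sum_(l <- s) f l]) /\
  (forall (s : seq X) (f : X -> V), uniq s ->
     (forall l, l \in s -> D l /\ W l (f l)) ->
     \sum_(l <- s) f l = 0 -> forall l, l \in s -> f l = 0).

Definition cat_C (V : lmodType Uq) : Prop :=
  direct_sum [set: X] (@weight_space V).

Definition cat_C_pi (pi : set X) (V : lmodType Uq) : Prop :=
  cat_C V /\ direct_sum (weyl_orbits pi) (@weight_space V).

Definition defining_ideal (pi : set X) : set Uq :=
  [set u | forall V : lmodType Uq, cat_C_pi pi V -> forall m : V, u *: m = 0].

Lemma defining_idealP pi : two_sided_ideal (defining_ideal pi).
Proof.
split=> [V _ m|x y Jx Jy V CV m|a x Jx V CV m|a x Jx V CV m].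
- exact: scale0r.
- by rewrite scalerDl Jx // Jy // addr0.
- by rewrite -scalerA Jx // scaler0.
- by rewrite -scalerA Jx.
Qed.

Definition q_schur (pi : set X) := quot (Ideal (defining_idealP pi)).

(* For a root datum of finite type W is finite, so that weyl_orbits pi is
   finite when pi is; the factors commute, so their order is irrelevant. *)
Definition K_prod (pi : set X) (h : Y) : Uq :=
  \prod_(l <- fset_set (weyl_orbits pi)) (UqK h - (q ^ <[h, l]>)%:A).

End RootDatum.

Arguments Uq {I C X Y} R {k} q.
Arguments UqE {I C X Y} R {k} q i.
Arguments UqF {I C X Y} R {k} q i.
Arguments UqK {I C X Y} R {k} q h.
Arguments defining_ideal {I C X Y} R {k} q pi _.
Arguments q_schur {I C X Y} R {k} q pi.
Arguments K_prod {I C X Y} R {k} q pi h.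

Definition Qv : fieldType := {fraction {poly rat}}.
Definition v : Qv := tofrac 'X.

(* Main.v *)
Require Import Defs.
From HB Require Import structures.
From mathcomp Require Import all_boot all_order all_algebra.
From mathcomp Require Import finmap boolp classical_sets cardinality.
From mathcomp Require Import ring lra zify.

Set Implicit Arguments.
Unset Strict Implicit.
Unset Printing Implicit Defensive.

Import Order.TTheory GRing.Theory Num.Theory.

Local Open Scope classical_set_scope.
Local Open Scope ring_scope.

(** Write J for the ideal generated by the elements
    prod_(l in W pi) (K_h - v^<h,l>).

    J is contained in the defining ideal: an object of C[pi] is spanned by
    weight vectors with weights in W pi, and on a vector of weight l the factor
    of index l of the product vanishes ([K_prod_weight]).  The product runs
    over a finite set because, in finite type, the W-orbits in X are finite
    ([weyl_orbits_finite]): the orbit of l lies in the translate by l of the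
    root lattice, and W preserves the norm of the projection to the root
    space, which is positive definite.

    Conversely, an element of U that annihilates the left module U/J lies in J,
    so it suffices that U/J is an object of C[pi].  More
    generally, every U-module V annihilated by all the products is one
    ([annihilated_cat_C_pi]).  Choose h such that the integers <h,l> are
    distinct for l in W pi; as v is not a root of unity, the product for h
    has simple roots as a polynomial in K_h, so Lagrange interpolation
    decomposes V into eigenspaces of K_h indexed by W pi.  The eigenspace of
    index l consists of vectors of weight l: for any other h', both K_h' and
    K_(h' + N h) are annihilated by their products, and for N large the only
    eigenvalue of K_h' compatible with both constraints is v^<h',l>, a simple
    root of the second of them ([separating_eigen_weight]). *)

(** * Operators annihilated by a split polynomial *)

Section PolynomialsInAnOperator.
Variables (k : fieldType) (A : algType k) (V : lmodType A).
Implicit Types (T : A) (m : V) (p : {poly k}).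

Lemma scalar_comm c T m : T *: (c%:A *: m) = c%:A *: (T *: m).
Proof. by rewrite !scalerA mulr_algl mulr_algr. Qed.

Lemma scale_algE c T m : (c *: T) *: m = c%:A *: (T *: m).
Proof. by rewrite scalerA mulr_algl. Qed.

Lemma horner_algZ T c p : horner_alg T (c *: p) = c *: horner_alg T p.
Proof. by rewrite -mul_polyC rmorphM /= horner_algC mulr_algl. Qed.

Lemma horner_alg_eigen T a m p :
  T *: m = a%:A *: m -> horner_alg T p *: m = (p.[a])%:A *: m.
Proof.
move=> Tm; elim/poly_ind: p => [|p c IHp].
  by rewrite rmorph0 horner0 !scale0r.
rewrite rmorphD rmorphM /= horner_algX horner_algC hornerMXaddC.
rewrite [LHS]scalerDl -[X in X + _]scalerA Tm scalar_comm IHp.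
by rewrite [X in X + _]scalerA mulr_algl scalerA mulrC -[LHS]scalerDl -scalerDl.
Qed.

Lemma horner_alg_coprime T m p p' : coprimep p p' ->
  horner_alg T p *: m = 0 -> horner_alg T p' *: m = 0 -> m = 0.
Proof.
move=> /Bezout_eq1_coprimepP[[u u'] /= uE] pm p'm.
rewrite -[m]scale1r -(rmorph1 (horner_alg T)) -uE rmorphD !rmorphM /=.
by rewrite scalerDl -!scalerA pm p'm !scaler0 addr0.
Qed.

(** On an eigenspace of T', the product T T' is a multiple of T, so the
    polynomial in T T' becomes a rescaled polynomial in T. *)
Lemma horner_alg_mul T T' c m p : GRing.comm T T' -> T' *: m = c%:A *: m ->
  horner_alg (T * T') p *: m = horner_alg T (p \Po (c *: 'X)) *: m.
Proof.
move=> TT'; elim/poly_ind: p m => [|p d IHp] m T'm.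
  by rewrite comp_poly0 !rmorph0.
rewrite comp_polyD comp_polyM comp_polyC comp_polyX !rmorphD !rmorphM /=.
rewrite horner_algZ !horner_algX !horner_algC !scalerDl -!scalerA.
congr (_ + _).
rewrite T'm scalar_comm [(c *: T) *: m]scale_algE; apply: IHp.
rewrite scalar_comm; congr (_ *: _).
by rewrite scalerA -TT' -scalerA T'm scalar_comm.
Qed.

Section Eigenvalues.
Variables (J : eqType) (s : seq J) (f : J -> k).
Hypotheses (us : uniq s) (f_inj : {in s &, injective f}).

Lemma prod_eigen0 T m j :
  T *: m = (f j)%:A *: m -> j \in s ->
  horner_alg T (\prod_(i <- s) ('X - (f i)%:P)) *: m = 0.
Proof.
move=> Tm js; rewrite (horner_alg_eigen _ Tm) horner_prod (big_rem j) //=.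
by rewrite hornerXsubC subrr mul0r !scale0r.
Qed.

Let cofactor j : {poly k} := \prod_(i <- s | i != j) ('X - (f i)%:P).

Let cofactorE j : j \in s ->
  ('X - (f j)%:P) * cofactor j = \prod_(i <- s) ('X - (f i)%:P).
Proof. by move=> js; rewrite [RHS](bigD1_seq j). Qed.

Let cofactor_neq0 j : j \in s -> (cofactor j).[f j] != 0.
Proof.
move=> js; rewrite horner_prod prodf_seq_neq0; apply/allP => i is_ /=.
apply/implyP => ij; rewrite hornerXsubC subr_eq0; apply: contraNneq ij => fij.
by apply/eqP; apply: f_inj.
Qed.

Let cofactor_eq0 i j : i \in s -> i != j -> (cofactor j).[f i] = 0.
Proof.
move=> is_ ij; rewrite horner_prod (big_rem i) //= ij.
by rewrite hornerXsubC subrr mul0r.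
Qed.

(** The polynomial omitting the factor of index j kills all the summands but
    the one of index j, on which it acts by a nonzero scalar. *)
Lemma eigen_independent T (g : J -> V) :
  (forall j, j \in s -> T *: g j = (f j)%:A *: g j) ->
  \sum_(j <- s) g j = 0 -> forall j, j \in s -> g j = 0.
Proof.
move=> Tg g0 j js; have := congr1 ( *:%R (horner_alg T (cofactor j))) g0.
rewrite scaler0 scaler_sumr (bigD1_seq j) //= big1_seq ?addr0; last first.
  move=> i /andP[ij is_].
  by rewrite (horner_alg_eigen _ (Tg i is_)) cofactor_eq0 // !scale0r.
rewrite (horner_alg_eigen _ (Tg j js)).
move=> /(congr1 ( *:%R ((cofactor j).[f j]^-1)%:A)).
by rewrite scaler0 scalerA mulr_algl scalerA mulVf ?cofactor_neq0 // !scale1r.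
Qed.

(** The components are given by the Lagrange polynomials [L j] of the nodes
    [f j]: their sum is 1 modulo the annihilating polynomial, which divides
    ('X - f j) * L j. *)
Lemma eigen_decomposition T m :
  horner_alg T (\prod_(j <- s) ('X - (f j)%:P)) *: m = 0 ->
  exists g : J -> V, (forall j, j \in s -> T *: g j = (f j)%:A *: g j) /\
    m = \sum_(j <- s) g j.
Proof.
move=> Pm; pose L j := (cofactor j).[f j]^-1 *: cofactor j.
have PL j : j \in s -> 'X * L j =
    f j *: L j + (cofactor j).[f j]^-1 *: \prod_(i <- s) ('X - (f i)%:P).
  move=> js; rewrite /L -(cofactorE js) mulrBl mul_polyC scalerBr -scalerAr.
  by rewrite !scalerA [f j * _]mulrC addrC subrK.
exists (fun j => horner_alg T (L j) *: m); split=> [j js|].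
  rewrite scalerA -[X in X * _]horner_algX -rmorphM PL // rmorphD.
  move: (L j) => Lj /=.
  rewrite !horner_algZ [LHS]scalerDl [X in _ + X]scale_algE Pm scaler0 addr0.
  by rewrite [LHS]scale_algE.
suff /(dvdpP) [r rE] : \prod_(j <- s) ('X - (f j)%:P) %| 1 - \sum_(j <- s) L j.
  apply/eqP; rewrite -scaler_suml -subr_eq0 -{1}[m]scale1r -scalerBl.
  rewrite -(rmorph1 (horner_alg T)) -rmorph_sum -rmorphB rE rmorphM.
  by rewrite -scalerA Pm scaler0.
rewrite -(big_map f xpredT (fun a => 'X - a%:P)).
apply: uniq_roots_dvdp; last by rewrite uniq_rootsE map_inj_in_uniq.
apply/allP => _ /mapP[j js ->].
rewrite rootE hornerD hornerN hornerC horner_sum.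
rewrite (bigD1_seq j) //= big1_seq ?addr0 => [|i /andP[ij _]].
  by rewrite hornerZ mulVf ?cofactor_neq0 // subrr.
by rewrite hornerZ (cofactor_eq0 (i := j)) ?mulr0 // eq_sym.
Qed.

End Eigenvalues.
End PolynomialsInAnOperator.

Lemma coprimep_prodXsubC (k : fieldType) (J : eqType) (s : seq J) (f : J -> k)
    (p : {poly k}) :
  (forall j, j \in s -> p.[f j] != 0) ->
  coprimep p (\prod_(j <- s) ('X - (f j)%:P)).
Proof.
elim: s => [|j s IHs] pf; first by rewrite big_nil coprimep1.
rewrite big_cons coprimepMr coprimep_XsubC rootE pf ?mem_head //=.
by apply: IHs => i is_; rewrite pf // inE is_ orbT.
Qed.

(** * Separating finitely many weights *)

Section Pairing.
Variables (I : finType) (C : cartan_datum I) (X Y : zmodType).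
Variable R : root_datum C X Y.

Fact pairing_zmod_morphism h : zmod_morphism (pairing R h).
Proof.
by move=> x y; apply/eqP; rewrite eq_sym subr_eq -pairingDr subrK.
Qed.

HB.instance Definition _ h :=
  GRing.isZmodMorphism.Build X int (pairing R h) (pairing_zmod_morphism h).

Lemma pairing0l x : pairing R 0 x = 0.
Proof. by apply: (addrI (pairing R 0 x)); rewrite -pairingDl !addr0. Qed.

Lemma pairingMnl h n x : pairing R (h *+ n) x = pairing R h x * n%:Z.
Proof.
elim: n => [|n IHn]; first by rewrite pairing0l mulr0.
by rewrite mulrS pairingDl IHn intS mulrDr mulr1.
Qed.

(** The coordinates on the free group X are pairings with elements of Y, the
    pairing being perfect. *)
Lemma pairing_nondegenerate x : (forall h, pairing R h x = 0) -> x = 0.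
Proof.
move=> x0; have [n [b [psi phiK psiK]]] := X_free R.
have psiB i : zmod_morphism (fun y => psi y i).
  move=> y z; suff -> : psi (y - z) = psi y - psi z by rewrite !ffunE.
  apply: (can_inj phiK); rewrite psiK -[in LHS](psiK y) -[in LHS](psiK z).
  by rewrite -sumrB; apply: eq_bigr => j _; rewrite !ffunE mulrzBr.
pose f i : {additive X -> int} :=
  HB.pack (fun y => psi y i) (GRing.isZmodMorphism.Build _ _ _ (psiB i)).
rewrite -[x]psiK big1 // => i _; have [h [hE _]] := pairing_perfectl R (f i).
by rewrite -[psi x i]/(f i x) -hE x0 mulr0z.
Qed.

(** Any N larger than all the constant terms works. *)
Lemma avoid_affine_zeros (s : seq (int * int)) :
  (forall p, p \in s -> p.1 != 0 \/ p.2 != 0) ->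
  exists N : nat, forall p, p \in s -> p.1 * N%:Z + p.2 != 0.
Proof.
move=> s_neq0; exists (\sum_(p <- s) `|p.2|).+1%N => -[a b] ab_s /=.
have := s_neq0 _ ab_s; rewrite (big_rem _ ab_s) /=.
move: (\sum_(_ <- _) _)%N => n ab; apply/eqP => abN.
have [a0|a0] := eqVneq a 0; first by case: ab => /eqP; lia.
suff: (`|b| = `|a| * (`|b| + n).+1)%N by have := absz_gt0 a; rewrite a0; nia.
by rewrite -(absz_nat (_ + n).+1) -abszM -abszN; congr absz; lia.
Qed.

(** By induction: if h avoids the hyperplanes of s and h' that of x, then
    N h + h' avoids all of them for a suitable N. *)
Lemma exists_regular (s : seq X) :
  (forall x, x \in s -> x != 0) ->
  exists h, forall x, x \in s -> pairing R h x != 0.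
Proof.
elim: s => [|x s IHs] s_neq0; first by exists 0.
have [y ys|h hs] := IHs; first by apply: s_neq0; rewrite inE ys orbT.
have /existsNP[h' /eqP h'x] : ~ forall h, pairing R h x = 0.
  by move/pairing_nondegenerate/eqP; apply/negP/s_neq0/mem_head.
have [|N NP] := @avoid_affine_zeros
    [seq (pairing R h y, pairing R h' y) | y <- x :: s].
  move=> _ /mapP[y + ->] /=; rewrite inE => /predU1P[->|ys]; first by right.
  by left; apply: hs.
exists (h *+ N + h') => y ys; rewrite pairingDl pairingMnl.
exact/(NP (_, _))/map_f.
Qed.

Lemma exists_separating (s : seq X) :
  exists h, {in s &, injective (pairing R h)}.
Proof.
have [|h hs] := @exists_regular [seq p.1 - p.2 | p <-
    [seq p <- [seq (x, y) | x <- s, y <- s] | p.1 != p.2]].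
  by move=> _ /mapP[p + ->]; rewrite mem_filter subr_eq0 => /andP[].
exists h => x y xs ys hxy; apply: contra_eq (hxy) => xy.
rewrite -subr_eq0 -raddfB; apply: hs; apply/mapP; exists (x, y) => //.
by rewrite mem_filter xy; apply/allpairsP; exists (x, y).
Qed.

End Pairing.

(** * Modules annihilated by the products *)

Section WeightModules.
Variables (I : finType) (C : cartan_datum I) (X Y : zmodType).
Variables (R : root_datum C X Y) (k : fieldType) (q : k).
Hypothesis q_inj : injective (fun n : int => q ^ n).

Local Notation U := (Uq R q).
Local Notation K := (UqK R q).
Local Notation piU := (@Uq_pi _ _ _ _ R _ q).

Lemma Uq_relator x :
  relator R q (Defs.freeE Y k) (freeF Y k) (freeK I k) x -> piU x = 0.
Proof.
move=> x_rel; apply/eqP; rewrite -(rmorph0 piU).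
by apply/quot_eqP; rewrite subr0 => J _; apply.
Qed.

Lemma UqK0 : K 0 = 1.
Proof.
apply/eqP; rewrite -subr_eq0 -(rmorph1 piU) -rmorphB.
by apply/eqP/Uq_relator/rel_K0.
Qed.

Lemma UqKD h h' : K (h + h') = K h * K h'.
Proof.
apply/eqP; rewrite eq_sym -subr_eq0 -rmorphM -rmorphB.
by apply/eqP/Uq_relator/rel_KK.
Qed.

Lemma UqKMn h n : K (h *+ n) = K h ^+ n.
Proof.
by elim: n => [|n IHn]; rewrite ?UqK0 // mulrS UqKD IHn exprS.
Qed.

Lemma UqK_comm h h' : GRing.comm (K h) (K h').
Proof. by rewrite /GRing.comm -!UqKD addrC. Qed.

Lemma K_prodE pi h : K_prod R q pi h = horner_alg (K h)
  (\prod_(l <- fset_set (weyl_orbits R pi)) ('X - (q ^ pairing R h l)%:P)).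
Proof.
rewrite rmorph_prod; apply: eq_bigr => l _.
by rewrite rmorphB /= horner_algX horner_algC.
Qed.

Variable V : lmodType U.

Lemma weight_independent (s : seq X) (f : X -> V) : uniq s ->
    (forall l, l \in s -> weight_space l (f l)) ->
  \sum_(l <- s) f l = 0 -> forall l, l \in s -> f l = 0.
Proof.
move=> us fs; have [h h_inj] := exists_separating R s.
apply: (@eigen_independent _ _ _ _ _ (fun l => q ^ pairing R h l) _ _ (K h))
  => //.
  by move=> x y xs ys /q_inj; apply: h_inj.
by move=> l ls; apply: fs.
Qed.

Variable pi : set X.
Hypothesis Wpi_finite : finite_set (weyl_orbits R pi).
Let S : seq X := fset_set (weyl_orbits R pi).

Let mem_S l : l \in S -> weyl_orbits R pi l.
Proof. by rewrite in_fset_set // inE. Qed.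

Lemma K_prod_weight l (m : V) h :
  weyl_orbits R pi l -> weight_space l m -> K_prod R q pi h *: m = 0 :> V.
Proof.
move=> Wl lm; rewrite K_prodE.
apply: (@prod_eigen0 _ _ _ _ _ (fun x => q ^ pairing R h x) _ _ l) => //.
by rewrite in_fset_set // inE.
Qed.

Hypothesis K_prod0 : forall h (m : V), K_prod R q pi h *: m = 0.

(** Fix h'. On m, K_(h' + N h) is K_h' times the scalar c = q^(N <h,l>), so
    that m is annihilated by two polynomials in K_h': the product for h', and
    the product for h' + N h with its variable scaled by c. The latter is
    'X - q^<h',l> times a polynomial whose roots q^(<h',x> + N <h,x - l>),
    for x != l, are distinct from all the q^<h',y> once N is large; the
    cofactor is then coprime to the product for h'. *)
Lemma separating_eigen_weight h l (m : V) :
    {in S &, injective (pairing R h)} -> l \in S ->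
  K h *: m = (q ^ pairing R h l)%:A *: m -> weight_space l m.
Proof.
move=> h_inj lS hm h'.
have [|N NP] := @avoid_affine_zeros [seq (pairing R h p.1 - pairing R h l,
    pairing R h' p.1 - pairing R h' p.2) |
    p <- [seq p <- [seq (x, y) | x <- S, y <- S] | p.1 != l]].
  move=> _ /mapP[p + ->] /=; rewrite mem_filter => /andP[pl].
  case/allpairsP=> -[x y] /= [xS yS pE]; left; rewrite subr_eq0.
  by apply: contraNneq pl; rewrite pE /= => /h_inj->.
have q_neq0 : q != 0.
  by apply/eqP => q0; have := @q_inj 1 2; rewrite q0 !exp0rz => /(_ erefl).
pose e h1 := fun x => q ^ pairing R h1 x; pose c := e h l ^+ N.
have KN : K (h *+ N) *: m = c%:A *: m.
  have := horner_alg_eigen 'X^N hm; rewrite hornerXn rmorphXn /= horner_algX.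
  by rewrite UqKMn.
have eD x : e (h' + h *+ N) x = e h' x * e h x ^+ N.
  by rewrite /e pairingDl expfzDr // pairingMnl -exprz_exp.
pose G := \prod_(x <- S | x != l) (c *: 'X - (e (h' + h *+ N) x)%:P).
have := K_prod0 (h' + h *+ N) m.
rewrite K_prodE UqKD (horner_alg_mul _ (UqK_comm _ _) KN) -/S.
have -> : \prod_(x <- S) ('X - (e (h' + h *+ N) x)%:P) \Po (c *: 'X) =
    c *: G * ('X - (e h' l)%:P).
  rewrite rmorph_prod (bigD1_seq l _ (fset_uniq _)) //=.
  rewrite comp_polyB comp_polyX comp_polyC.
  rewrite eD -/c [_ * c]mulrC polyCM mul_polyC -scalerBr -!scalerAl.
  rewrite mulrC; congr (_ *: (_ * _)); apply: eq_bigr => x _.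
  by rewrite comp_polyB comp_polyX comp_polyC.
rewrite rmorphM -scalerA => Gm'.
suff m'0 : horner_alg (K h') ('X - (e h' l)%:P) *: m = 0.
  apply/eqP; rewrite -subr_eq0 -scalerBl -{}m'0.
  by rewrite rmorphB /= horner_algX horner_algC.
have := K_prod0 h' (horner_alg (K h') ('X - (e h' l)%:P) *: m).
rewrite K_prodE; apply: horner_alg_coprime Gm'.
apply: coprimep_prodXsubC => y yS.
rewrite hornerZ mulf_neq0 ?expf_neq0 ?expfz_neq0 // horner_prod.
rewrite prodf_seq_neq0; apply/allP => x xS; apply/implyP => xl.
rewrite hornerD hornerN hornerZ hornerX hornerC subr_eq0.
rewrite /c /e -[_ ^+ N]/(_ ^ N%:Z) exprz_exp -expfzDr //.
apply/eqP => /q_inj; rewrite pairingDl pairingMnl => xy.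
have /eqP[] : (pairing R h x - pairing R h l) * N%:Z +
    (pairing R h' x - pairing R h' y) != 0; last by rewrite mulrBl; lia.
apply: (NP (_, _)); apply: (map_f _ (x := (x, y))).
by rewrite mem_filter xl; apply/allpairsP; exists (x, y).
Qed.

Lemma annihilated_cat_C_pi : cat_C_pi pi V.
Proof.
have dec m : exists (s : seq X) (f : X -> V), [/\ uniq s,
    forall l, l \in s -> weyl_orbits R pi l /\ weight_space l (f l)
    & m = \sum_(l <- s) f l].
  have [h h_inj] := exists_separating R S.
  have := K_prod0 h m; rewrite K_prodE.
  move=> /(eigen_decomposition (fset_uniq _)) [].
    by move=> x y xS yS /q_inj; apply: h_inj.
  move=> g [hg mE]; exists S, g; split=> [|l lS|//]; first exact: fset_uniq.
  split; first exact: mem_S.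
  exact: separating_eigen_weight (hg l lS).
(split; split) => [m|s f us fs|//|s f us fs].
- by have [s [f [us fs mE]]] := dec m; exists s, f; split=> // l /fs[].
- by apply: weight_independent => // l /fs[].
- by apply: weight_independent => // l /fs[].
Qed.

End WeightModules.

(** * The positive definite form on the root space *)

Section CartanForm.
Variables (I : finType) (C : cartan_datum I).

Local Notation E := {ffun I -> rat^o}.
Implicit Types x y z : E.

Definition dot x y : rat := \sum_i x i * y i.
Definition gram x : E := [ffun i => \sum_j (C i j)%:Q * x j].

Fact gram_is_linear : linear gram.
Proof.
move=> a x y; apply/ffunP => i; rewrite !ffunE scaler_sumr -big_split.
by apply: eq_bigr => j _ /=; rewrite !ffunE /GRing.scale /=; ring.
Qed.

HB.instance Definition _ :=
  GRing.isLinear.Build rat E E *:%R gram gram_is_linear.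

Lemma dotC x y : dot x y = dot y x.
Proof. by apply: eq_bigr => i _; rewrite mulrC. Qed.

Lemma dotDl x y z : dot (x + y) z = dot x z + dot y z.
Proof. by rewrite -big_split; apply: eq_bigr => i _; rewrite ffunE mulrDl. Qed.

Lemma dotZl a x z : dot (a *: x) z = a * dot x z.
Proof. by rewrite mulr_sumr; apply: eq_bigr => i _; rewrite ffunE -mulrA. Qed.

Lemma dotNl x z : dot (- x) z = - dot x z.
Proof. by rewrite -sumrN; apply: eq_bigr => i _; rewrite ffunE mulNr. Qed.

Lemma dotDr x y z : dot z (x + y) = dot z x + dot z y.
Proof. by rewrite dotC dotDl !(dotC z). Qed.

Lemma dotNr x z : dot z (- x) = - dot z x.
Proof. by rewrite dotC dotNl dotC. Qed.

Lemma dotZr a x z : dot z (a *: x) = a * dot z x.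
Proof. by rewrite dotC dotZl dotC. Qed.

Lemma dot0l x : dot 0 x = 0.
Proof. by rewrite -(scale0r 0) dotZl mul0r. Qed.

Lemma dot0r x : dot x 0 = 0.
Proof. by rewrite dotC dot0l. Qed.

Lemma dot_gram_sym x y : dot x (gram y) = dot y (gram x).
Proof.
rewrite /dot; under eq_bigr do rewrite ffunE mulr_sumr.
rewrite exchange_big; apply: eq_bigr => i _; rewrite ffunE mulr_sumr.
by apply: eq_bigr => j _; rewrite (cartan_form_sym C i j); ring.
Qed.

Hypothesis C_fin : cartan_finite C.

Lemma gram_gt0 x : x != 0 -> 0 < dot x (gram x).
Proof.
move=> x0; rewrite /dot; under eq_bigr do rewrite ffunE mulr_sumr.
under eq_bigr do under eq_bigr do rewrite mulrA.
apply: C_fin; apply: contrapT => /forallNP x_0; case/eqP: x0; apply/ffunP => i.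
by rewrite ffunE; apply/eqP; have /negP := x_0 i; rewrite negbK.
Qed.

(** A definite form is nondegenerate, and an injective endomorphism of a
    finite-dimensional space is surjective. *)
Lemma gram_surj y : exists x, gram x = y.
Proof.
have : limg (linfun gram) = fullv.
  apply: lker0_limgf; apply/eqP; apply/vspaceP => x.
  rewrite memv_ker lfunE memv0 /=.
  apply/eqP/eqP => [gx|->]; last exact: linear0.
  have [//|/gram_gt0] := eqVneq x 0.
  by rewrite gx dot0r ltxx.
move/vspaceP/(_ y); rewrite memvf => /memv_imgP[x _ ->].
by exists x; rewrite lfunE.
Qed.

(** The norm of (y,y) x - (x,y) y is (y,y) times the difference of the two
    sides. *)
Lemma gram_cauchy_schwarz x y :
  dot x (gram y) ^+ 2 <= dot x (gram x) * dot y (gram y).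
Proof.
have [->|y0] := eqVneq y 0.
  by rewrite linear0 !dot0r mulr0 expr0n.
have ge0 z : 0 <= dot z (gram z).
  by have [->|/gram_gt0/ltW//] := eqVneq z 0; rewrite dot0l.
have yy := gram_gt0 y0; set a := dot y _ in yy *; set b := dot x (gram y).
have := ge0 (a *: x - b *: y).
rewrite linearB !linearZ /= !(dotDl, dotDr, dotNl, dotNr, dotZl, dotZr).
rewrite (dot_gram_sym y x) -/a -/b => H.
rewrite -subr_ge0 -(pmulr_rge0 _ yy).
by move: H; rewrite /GRing.scale /=; lra.
Qed.

End CartanForm.

(** * Finiteness of the Weyl group orbits *)

Section Orbits.
Variables (I : finType) (C : cartan_datum I) (X Y : zmodType).
Variable R : root_datum C X Y.

Local Notation E := {ffun I -> rat^o}.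
Local Notation "<[ h , l ]>" := (pairing R h l).

Definition root_comb (c : {ffun I -> int}) : X :=
  \sum_i simple_root R i *~ c i.
Definition ratv (c : {ffun I -> int}) : E := [ffun i => (c i)%:Q].
(** The vector of the (alpha_i, l), for the form extended to X. *)
Definition root_coord (l : X) : E :=
  [ffun i => (C i i)%:Q / 2 * <[simple_coroot R i, l]>%:Q].

Lemma root_combD c c' : root_comb (c + c') = root_comb c + root_comb c'.
Proof. by rewrite -big_split; apply: eq_bigr => i _; rewrite ffunE mulrzDr. Qed.

Lemma root_combN c : root_comb (- c) = - root_comb c.
Proof. by rewrite -sumrN; apply: eq_bigr => i _; rewrite ffunE mulrNz. Qed.

Lemma ratvD c c' : ratv (c + c') = ratv c + ratv c'.
Proof. by apply/ffunP => i; rewrite !ffunE intrD. Qed.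

Lemma ratvN c : ratv (- c) = - ratv c.
Proof. by apply/ffunP => i; rewrite !ffunE rmorphN. Qed.

Lemma cartan_diag_neq0 i : (C i i)%:Q != 0.
Proof. by have [n n0 ->] := cartan_form_diag C i; rewrite intr_eq0; lia. Qed.

Lemma root_coordD l c :
  root_coord (l + root_comb c) = root_coord l + gram C (ratv c).
Proof.
apply/ffunP => i; rewrite !ffunE pairingDr intrD mulrDr; congr (_ + _).
rewrite raddf_sum rmorph_sum mulr_sumr; apply: eq_bigr => j _ /=.
rewrite raddfMz mulrzz intrM ffunE pairing_root mulrA.
by field; exact: cartan_diag_neq0.
Qed.

(** The equality (l + c, l + c) = (l, l), expanded so as to involve only the
    form on the root space and its extension to pairs in root space times X:
    no form on X itself has to be chosen. *)
Definition same_norm (l : X) (c : {ffun I -> int}) : Prop :=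
  dot (ratv c) (gram C (ratv c)) + 2 * dot (ratv c) (root_coord l) = 0.

(** Quantifying over all l makes the property stable under composition and
    inversion. *)
Lemma weyl_same_norm w : weyl R w ->
  forall l, exists2 c, w l = l + root_comb c & same_norm l c.
Proof.
elim=> {w} [|i|w w' _ IHw _ IHw'|w w' _ IHw ww' w'w] l.
- exists 0.
    by rewrite /root_comb big1 ?addr0 // => i _; rewrite ffunE mulr0z.
  suff r0 : ratv 0 = 0 by rewrite /same_norm r0 !dot0l mulr0 addr0.
  by apply/ffunP => i; rewrite !ffunE.
- exists [ffun j => if j == i then - <[simple_coroot R i, l]> else 0].
    rewrite /root_comb (bigD1 i) //= big1 => [|j /negPf ji];
      rewrite ffunE ?ji //.
    by rewrite eqxx mulrNz addr0.
  have dotE (x : E) : dot (ratv [ffun j => if j == i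
      then - <[simple_coroot R i, l]> else 0]) x =
      - <[simple_coroot R i, l]>%:Q * x i.
    rewrite /dot (bigD1 i) //= big1 => [|j /negPf ji];
      rewrite !ffunE ?ji ?mul0r //.
    by rewrite eqxx addr0 rmorphN.
  rewrite /same_norm !dotE !ffunE (bigD1 i) //= big1 => [|j /negPf ji].
    by rewrite !ffunE eqxx rmorphN; field.
  by rewrite !ffunE ji mulr0.
- have [c' w'l c'P] := IHw' l; have [c wl cP] := IHw (w' l).
  exists (c' + c); first by rewrite /= wl w'l root_combD addrA.
  move: c'P cP; rewrite /same_norm w'l root_coordD ratvD.
  rewrite linearD !(dotDl, dotDr) (dot_gram_sym C (ratv c') (ratv c)).
  lra.
- have [c wl cP] := IHw (w' l); rewrite w'w in wl.
  exists (- c); first by rewrite root_combN [in RHS]wl addrK.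
  move: cP; rewrite /same_norm ratvN linearN !(dotNl, dotNr) opprK.
  rewrite [in X in _ -> X]wl root_coordD dotDr.
  lra.
Qed.

Hypothesis C_fin : cartan_finite C.

(** Let t be the projection of l to the root space. Then c + t has the norm
    of t, and its i-th coordinate is its scalar product with the i-th dual
    basis vector u i, which Cauchy-Schwarz bounds. *)
Lemma same_norm_bounded l :
  exists M : nat, forall c, same_norm l c -> forall i, (`|c i| <= M)%N.
Proof.
have [t tE] := gram_surj C_fin (root_coord l).
have /fin_all_exists[u uE] i := gram_surj C_fin [ffun j => (j == i)%:R].
pose B i : rat := dot t (root_coord l) * dot (u i) (gram C (u i)).
pose b i : nat := Num.bound (B i + `|t i| + 1).
exists (\sum_i b i)%N => c cP i.
have zz : dot (ratv c + t) (gram C (ratv c + t)) = dot t (root_coord l).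
  rewrite linearD /= !(dotDl, dotDr) (dot_gram_sym C t (ratv c)) tE.
  by move: cP; rewrite /same_norm; lra.
have zE : dot (ratv c + t) (gram C (u i)) = (c i)%:Q + t i.
  rewrite uE /dot (bigD1 i) //= big1 => [|j /negPf ji];
    rewrite !ffunE ?ji ?mulr0 //.
  by rewrite eqxx mulr1 addr0.
have := gram_cauchy_schwarz C_fin (ratv c + t) (u i).
rewrite zz zE -/(B i) => zB.
have cb : `|(c i)%:Q| <= B i + `|t i| + 1.
  have : `|(c i)%:Q + t i| <= B i + 1.
    (* n ^ 2 <= B i gives n <= B i + 1 / 4 because 0 <= (n - 1 / 2) ^ 2. *)
    have := sqr_ge0 (`|(c i)%:Q + t i| - 2^-1).
    rewrite -real_normK ?num_real // in zB; move: zB.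
    by move: `|_| (B i) => n b' ; lra.
  have := ler_normB ((c i)%:Q + t i) (t i); rewrite addrK; lra.
apply: (@leq_trans (b i)); last by rewrite (bigD1 i) //= leq_addr.
apply/ltnW; rewrite -(ltr_nat rat) natr_absz intr_norm.
apply: (le_lt_trans cb); apply: archi_boundP.
exact: le_trans (normr_ge0 _) cb.
Qed.

Lemma weyl_orbits_finite (pi : set X) :
  finite_set pi -> finite_set (weyl_orbits R pi).
Proof.
move=> pi_fin; have -> : weyl_orbits R pi =
    \bigcup_(l in pi) [set l' | exists2 w, weyl R w & l' = w l].
  apply/seteqP; split=> l' /=.
    by move=> [w [l [? ? ->]]]; exists l => //=; exists w.
  by move=> [l pil /= [w ww ->]]; exists w, l.
apply: bigcup_finite => // l _; have [M MP] := same_norm_bounded l.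
pose g (d : {ffun I -> 'I_(2 * M).+1}) :=
  l + root_comb [ffun i => (d i : nat)%:Z - M%:Z].
apply: sub_finite_set (finite_seq [seq g d | d <- enum predT]).
move=> _ /= [w ww ->]; have [c -> /MP cM] := weyl_same_norm ww l.
apply/mapP; exists [ffun i => inord `|(c i + M%:Z)%R|%N].
  by rewrite mem_enum.
congr (l + root_comb _); apply/ffunP => i; rewrite !ffunE inordK.
  by have := cM i; lia.
by have := cM i; lia.
Qed.

End Orbits.

(** * The defining ideal *)

Section QuotientModule.
Variables (A : nzRingType) (J : ideal A).

(** The left regular module modulo J; an alias, because [quot J] already
    carries the module structure over the ground field. *)
Definition quot_module := quot J.

HB.instance Definition _ := GRing.Zmodule.on quot_module.

Let act (a : A) (x : quot_module) : quot_module := quot_pi J a * (x : quot J).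

Fact quot_module_scaleA a b x : act a (act b x) = act (a * b) x.
Proof. by rewrite /act rmorphM mulrA. Qed.

Fact quot_module_scale1 : left_id 1 act.
Proof. by move=> x; rewrite /act rmorph1 mul1r. Qed.

Fact quot_module_scaleDr : right_distributive act +%R.
Proof. by move=> a x y; rewrite /act mulrDr. Qed.

Fact quot_module_scaleDl x : {morph act^~ x : a b / a + b}.
Proof. by move=> a b; rewrite /act rmorphD mulrDl. Qed.

HB.instance Definition _ := GRing.Zmodule_isLmodule.Build A quot_module
  quot_module_scaleA quot_module_scale1 quot_module_scaleDr
  quot_module_scaleDl.

Lemma quot_module_scaleE a x :
  a *: (quot_pi J x : quot_module) = quot_pi J (a * x).
Proof. by rewrite rmorphM. Qed.

Lemma quot_module_faithful a :
  (forall m : quot_module, a *: m = 0) -> J a.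
Proof.
move=> a0; rewrite -[a]subr0; apply/quot_eqP; rewrite rmorph0 -[a]mulr1.
by rewrite -quot_module_scaleE a0.
Qed.

Lemma quot_module_ann a (m : quot_module) : J a -> a *: m = 0.
Proof.
move=> Ja; suff pia : quot_pi J a = 0.
  by rewrite -[LHS]/(act _ _) /act pia mul0r.
by rewrite -(rmorph0 (quot_pi J)); apply/eqP/quot_eqP; rewrite subr0.
Qed.

End QuotientModule.

Lemma v_exprz_inj : injective (fun n : int => v ^ n).
Proof.
have v_neq0 : v != 0 by rewrite tofrac_eq0 polyX_eq0.
have v_exp n : v ^+ n = 1 -> n = 0%N.
  rewrite -rmorphXn -(rmorph1 (@tofrac {poly rat})) => /eqP.
  rewrite tofrac_eq => /eqP Xn1.
  by have := size_polyXn rat n; rewrite Xn1 size_polyC oner_eq0 => -[].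
move=> m n /= mn; apply/eqP; rewrite -subr_eq0; apply/eqP.
have : v ^ (m - n) = 1 by rewrite expfzDr // mn -expfzDr // subrr.
case: (m - n) => d; first by move/v_exp->.
by move=> /eqP; rewrite -[_ ^ _]/((v ^+ d.+1)^-1) invr_eq1 => /eqP/v_exp.
Qed.

Theorem corollary4p17 (I : finType) (C : cartan_datum I) (X Y : zmodType)
    (R : root_datum C X Y) (pi : set X) :
  cartan_finite C ->
  pi `<=` dominant R -> saturated R pi -> finite_set pi ->
  defining_ideal R v pi = ideal_gen [set K_prod R v pi h | h in [set: Y]].
Proof.
move=> C_fin _ _ /(weyl_orbits_finite R C_fin) Wpi_fin.
apply/seteqP; split=> [u Lu|u].
  apply: (@quot_module_faithful _ (gen_ideal _)) => m; apply: Lu.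
  apply: (annihilated_cat_C_pi v_exprz_inj Wpi_fin) => h m'.
  by apply: quot_module_ann => J _; apply; exists h.
apply; first exact: defining_idealP.
move=> _ [h _ <-] V [_ [V_dec _]] m; have [s [f [_ fs ->]]] := V_dec m.
rewrite scaler_sumr big1_seq // => l /andP[_ /fs[Wl wl]].
exact: K_prod_weight wl.
Qed.
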